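(* Let $R$ be a commutative ring with identity, $S$ a multiplicatively closed subset of $R$, $M$ an $R$-module, and $P$ a submodule of $M$ with $(P:_R M)\cap S=\emptyset$. Then the following are equivalent: (a) $P$ is an $S$-primary submodule of $M$; (b) there exists $s\in S$ such that for every $r\in R$, either the endomorphism $s(M/P)\to s(M/P)$ given by $s\overline{m}=sm+P\mapsto rs\overline{m}=rsm+P$ is injective, or $(rs)^t(M/P)=(\overline{0})$ for some $t\in\mathbb{N}$; (c) there exists $s\in S$ such that whenever $rN\subseteq P$, where $N$ is a submodule of $M$ and $r\in R$, then $sr\in\sqrt{(P:_R M)}$ or $sN\subseteq P$; (d) there exists $s\in S$ such that whenever $JN\subseteq P$, where $N$ is a submodule of $M$ and $J$ is an ideal of $R$, then $sJ\subseteq\sqrt{(P:_R M)}$ or $sN\subseteq P$.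
   Context: All rings are commutative with identity and all modules are unital. A multiplicatively closed subset $S$ of $R$ is a non-empty subset with $0\notin S$, $1\in S$, and $ss'\in S$ for all $s,s'\in S$. For submodules $N,K$ of an $R$-module $M$, $(N:_R K)=\{r\in R : rK\subseteq N\}$. For an ideal $I$, $\sqrt{I}$ is its radical. A submodule $P$ of $M$ with $(P:_R M)\cap S=\emptyset$ is called $S$-primary if there exists $s\in S$ such that whenever $rm\in P$ with $r\in R$, $m\in M$, then $sr\in\sqrt{(P:_R M)}$ or $sm\in P$. *)

(* Defs.v *)
From HB Require Import structures.
From mathcomp Require Import all_boot all_algebra.
From mathcomp Require Import boolp.

Set Implicit Arguments.
Unset Strict Implicit.
Unset Printing Implicit Defensive.

Import GRing.Theory.

Local Open Scope ring_scope.
Local Open Scope quotient_scope.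

(* Subsets are boolean predicates; since `[< _ >] turns any proposition into a
   boolean, a [submodClosed M] is an arbitrary submodule of M, and a
   [submodClosed R^o] is an arbitrary (possibly improper) ideal of R. *)

Definition mult_closed (R : comPzRingType) (S : {pred R}) : Prop :=
  0 \notin S /\ GRing.mulr_closed S.

(* r K = { r k | k in K } *)
Definition scale_pred (R : comPzRingType) (M : lmodType R) (r : R)
    (K : {pred M}) : {pred M} :=
  fun x => `[< exists2 k, k \in K & x = r *: k >].

(* J N: finite sums of products j n with j in J and n in N *)
Definition prod_pred (R : comPzRingType) (M : lmodType R) (J : {pred R})
    (N : {pred M}) : {pred M} :=
  fun x => `[< exists2 s : seq (R * M),
      {in s, forall p, p.1 \in J /\ p.2 \in N} &
      x = \sum_(p <- s) p.1 *: p.2 >].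

(* (N :_R K) *)
Definition colon (R : comPzRingType) (M : lmodType R) (N K : {pred M}) :
    {pred R} :=
  fun r => `[< {subset scale_pred r K <= N} >].

Definition radical (R : comPzRingType) (I : {pred R}) : {pred R} :=
  fun r => `[< exists2 n : nat, (0 < n)%N & r ^+ n \in I >].

Definition S_primary (R : comPzRingType) (S : {pred R}) (M : lmodType R)
    (P : submodClosed M) : Prop :=
  [predI colon P predT & S] =i pred0 /\
  exists2 s : R, s \in S & forall (r : R) (m : M), r *: m \in P ->
    s * r \in radical (colon P predT) \/ s *: m \in P.

Section QuotientModule.
Variables (R : comPzRingType) (M : lmodType R) (P : submodClosed M).

Definition submod_zmod : {pred M} := P.

Fact submod_zmod_closed : GRing.zmod_closed submod_zmod.
Proof. exact: GRing.submod_closedB (submodClosedP P). Qed.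

HB.instance Definition _ :=
  GRing.isZmodClosed.Build M submod_zmod submod_zmod_closed.

Definition quotmod : Type := {ideal_quot submod_zmod}.

HB.instance Definition _ := GRing.Zmodule.on quotmod.

Definition quotmod_pi (m : M) : quotmod := \pi_({ideal_quot submod_zmod}) m.

(* r (m + P) = r m + P, see [quotmod_piZ] *)
Definition quotmod_scale (r : R) (x : quotmod) : quotmod :=
  quotmod_pi (r *: repr (x : {ideal_quot submod_zmod})).

Lemma quotmod_piE (m n : M) : (quotmod_pi m = quotmod_pi n) <-> (m - n \in P).
Proof.
split=> [e|Pmn].
- by have := Quotient.idealrBE submod_zmod m n => /= ->; apply/eqP.
- by apply/eqP; have := Quotient.idealrBE submod_zmod m n => /= <-.
Qed.

Lemma quotmod_pi_repr (x : quotmod) :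
  quotmod_pi (repr (x : {ideal_quot submod_zmod})) = x.
Proof. exact: reprK. Qed.

Lemma quotmod_piD (m n : M) : quotmod_pi (m + n) = quotmod_pi m + quotmod_pi n.
Proof. exact: (@raddfD _ _ \pi_({ideal_quot submod_zmod})). Qed.

Lemma quotmod_piZ' (r : R) (m : M) :
  quotmod_scale r (quotmod_pi m) = quotmod_pi (r *: m).
Proof.
apply/quotmod_piE; rewrite -scalerBr; apply: rpredZ.
by apply/quotmod_piE; rewrite quotmod_pi_repr.
Qed.

Fact quotmod_scaleA (a b : R) (x : quotmod) :
  quotmod_scale a (quotmod_scale b x) = quotmod_scale (a * b) x.
Proof. by rewrite -(quotmod_pi_repr x) !quotmod_piZ' scalerA. Qed.

Fact quotmod_scale1 : left_id 1 quotmod_scale.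
Proof. by move=> x; rewrite -(quotmod_pi_repr x) quotmod_piZ' scale1r. Qed.

Fact quotmod_scaleDr : right_distributive quotmod_scale +%R.
Proof.
move=> a x y; rewrite -(quotmod_pi_repr x) -(quotmod_pi_repr y).
by rewrite -quotmod_piD !quotmod_piZ' scalerDr quotmod_piD.
Qed.

Fact quotmod_scaleDl (x : quotmod) :
  {morph quotmod_scale^~ x : a b / a + b}.
Proof.
move=> a b; rewrite -(quotmod_pi_repr x).
by rewrite !quotmod_piZ' scalerDl quotmod_piD.
Qed.

HB.instance Definition _ := GRing.Zmodule_isLmodule.Build R quotmod
  quotmod_scaleA quotmod_scale1 quotmod_scaleDr quotmod_scaleDl.

Lemma quotmod_piZ (r : R) (m : M) : r *: quotmod_pi m = quotmod_pi (r *: m).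
Proof. exact: quotmod_piZ'. Qed.

End QuotientModule.

Section ScaledModule.
Variables (R : comPzRingType) (s : R) (V : lmodType R).

Definition scaled_pred : {pred V} := scale_pred s predT.

Fact scaled_pred_closed : GRing.subsemimod_closed scaled_pred.
Proof.
split; first split.
- by apply/asboolP; exists 0; rewrite ?scaler0.
- move=> x y /asboolP[a _ ->] /asboolP[b _ ->].
  by apply/asboolP; exists (a + b); rewrite ?scalerDr.
- move=> r x /asboolP[a _ ->].
  by apply/asboolP; exists (r *: a); rewrite // !scalerA mulrC.
Qed.

HB.instance Definition _ :=
  GRing.isSubmodClosed.Build R V scaled_pred scaled_pred_closed.

(* the R-module s V, as a type *)
Record scaled_mod := ScaledMod
  { scaled_val :> V; scaled_valP : scaled_val \in scaled_pred }.

HB.instance Definition _ := [isSub for scaled_val].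
HB.instance Definition _ := [Choice of scaled_mod by <:].
HB.instance Definition _ := [SubChoice_isSubLmodule of scaled_mod by <:].

End ScaledModule.

(* multiplication by r, as an endomorphism of s V: s x |-> r s x *)
Definition scaled_endo (R : comPzRingType) (s : R) (V : lmodType R) (r : R) :
    scaled_mod s V -> scaled_mod s V :=
  fun x => r *: x.

Fact scaled_endo_linear (R : comPzRingType) (s : R) (V : lmodType R) (r : R) :
  linear (@scaled_endo R s V r).
Proof.
by move=> a x y; rewrite /scaled_endo scalerDr !scalerA (mulrC r).
Qed.

HB.instance Definition _ (R : comPzRingType) (s : R) (V : lmodType R) (r : R) :=
  GRing.isLinear.Build R (scaled_mod s V) (scaled_mod s V) *:%R
    (@scaled_endo R s V r) (@scaled_endo_linear R s V r).

(* Main.v *)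
Require Import Defs.
From HB Require Import structures.
From mathcomp Require Import all_boot all_algebra.
From mathcomp Require Import boolp.

Import GRing.Theory.

Local Open Scope ring_scope.

(** The conditions are proved in a cycle, and one and the same [s] serves throughout. Modulo [P],
    injectivity of multiplication by [r] on s(M/P) says that rsm in [P] forces sm in [P]
    ([scaled_endo_quotmod_inj]), while (rs)^t (M/P) = 0 says that (rs)^t lies in the colon ideal
    ([scale_quotmod_eq0]). So (b) is a statement about elements of [M], close to S-primarity. From
    there, elements pass to submodules and then to ideals pointwise, and cyclic submodules lead back
    to elements. *)

Section CyclicSubmodule.
Variables (R : comPzRingType) (M : lmodType R) (m : M).

(** Taken in [M] this is Rm; taken in [R^o] it is the principal ideal. Both are needed to specialise
    (d) to single elements. *)
Definition cyclic_submod : {pred M} := fun x => `[< exists a : R, x = a *: m >].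

Fact cyclic_submod_closed : GRing.subsemimod_closed cyclic_submod.
Proof.
split; first split.
- by apply/asboolP; exists 0; rewrite scale0r.
- move=> x y /asboolP[a ->] /asboolP[b ->].
  by apply/asboolP; exists (a + b); rewrite scalerDl.
- move=> r x /asboolP[a ->].
  by apply/asboolP; exists (r * a); rewrite scalerA.
Qed.

HB.instance Definition _ :=
  GRing.isSubmodClosed.Build R M cyclic_submod cyclic_submod_closed.

Lemma mem_cyclic_submod : m \in cyclic_submod.
Proof. by apply/asboolP; exists 1; rewrite scale1r. Qed.

End CyclicSubmodule.

Lemma scale_pred_subP (R : comPzRingType) (M : lmodType R) (r : R)
    (K P : {pred M}) :
  {subset scale_pred r K <= P} <-> (forall k, k \in K -> r *: k \in P).
Proof.
split=> [rKP k Kk|rKP x /asboolP[k Kk ->]]; last exact: rKP.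
by apply: rKP; apply/asboolP; exists k.
Qed.

Lemma mem_colonT (R : comPzRingType) (M : lmodType R) (P : {pred M}) (r : R) :
  r \in colon P predT <-> forall m, r *: m \in P.
Proof.
split=> [/asboolP/scale_pred_subP rMP m|rMP]; first exact: rMP.
by apply/asboolP/scale_pred_subP => m _.
Qed.

Lemma quotmod_pi_eq0 (R : comPzRingType) (M : lmodType R) (P : submodClosed M)
    (m : M) : quotmod_pi P m = 0 <-> m \in P.
Proof.
have <- : quotmod_pi P 0 = 0 by rewrite -(scale0r 0) -quotmod_piZ scale0r.
by rewrite quotmod_piE subr0.
Qed.

Lemma scale_quotmod_eq0 (R : comPzRingType) (M : lmodType R)
    (P : submodClosed M) (r : R) :
  scale_pred r (predT : {pred quotmod P}) =i pred1 0 <-> r \in colon P predT.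
Proof.
split=> [rQ0|/mem_colonT rMP x].
  apply/mem_colonT => m; apply/quotmod_pi_eq0/eqP.
  rewrite -[_ == 0]/(_ \in pred1 0) -rQ0.
  by apply/asboolP; exists (quotmod_pi P m); rewrite ?quotmod_piZ.
apply/asboolP/eqP => [[k _ ->]|->]; last by exists 0; rewrite ?scaler0.
by rewrite -(quotmod_pi_repr k) quotmod_piZ; apply/quotmod_pi_eq0.
Qed.

(** Every element of s(M/P) is the class of some sm: it is zero iff sm is in [P], and [r] kills it
    iff rsm is in [P]. The right side thus says that the kernel is trivial. *)
Lemma scaled_endo_quotmod_inj (R : comPzRingType) (M : lmodType R)
    (P : submodClosed M) (s r : R) :
  injective (@scaled_endo R s (quotmod P) r) <->
  forall m, (r * s) *: m \in P -> s *: m \in P.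
Proof.
split=> [inj m rsmP|rsP].
  have smP : quotmod_pi P (s *: m) \in @scaled_pred R s (quotmod P).
    by apply/asboolP; exists (quotmod_pi P m); rewrite ?quotmod_piZ.
  suff /(congr1 val) : ScaledMod smP = 0 by move/quotmod_pi_eq0.
  apply: inj; rewrite [RHS]linear0; apply: val_inj.
  rewrite /scaled_endo linearZ /= quotmod_piZ scalerA.
  exact/quotmod_pi_eq0.
apply: raddf_inj => x /(congr1 val).
rewrite /scaled_endo linearZ linear0 => rx0; apply: val_inj; rewrite linear0.
have /asboolP[k _] := scaled_valP x.
rewrite -(quotmod_pi_repr k) quotmod_piZ => xE.
move: rx0; rewrite /= xE quotmod_piZ scalerA.
by move=> /quotmod_pi_eq0/rsP smP; apply/quotmod_pi_eq0.
Qed.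

Theorem theorem2p2 (R : comPzRingType) (S : {pred R}) (hS : mult_closed S)
    (M : lmodType R) (P : submodClosed M)
    (hPS : [predI colon P predT & S] =i pred0) :
  [<-> S_primary S P;
       exists2 s : R, s \in S & forall r : R,
         injective (@scaled_endo R s (quotmod P) r) \/
         (exists2 t : nat, (0 < t)%N &
            scale_pred ((r * s) ^+ t) (predT : {pred quotmod P})
              =i pred1 0);
       exists2 s : R, s \in S & forall (r : R) (N : submodClosed M),
         {subset scale_pred r N <= P} ->
         s * r \in radical (colon P predT) \/ {subset scale_pred s N <= P};
       exists2 s : R, s \in S &
         forall (J : submodClosed R^o) (N : submodClosed M),
         {subset @prod_pred R M J N <= P} ->
         {subset scale_pred s J <= radical (colon P predT)} \/
         {subset scale_pred s N <= P}].
Proof.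
tfae.
- case=> _ [s Ss primP]; exists s => // r.
  (* [S]-primarity is used at [r * s], so that the same [s] works in (b). *)
  have [/asboolP[n n_gt0 /mem_colonT srsn]|srsN] :=
    pselect (s * (r * s) \in radical (colon P predT)).
    right; exists (n + n)%N; first by rewrite addn_gt0 n_gt0.
    apply/scale_quotmod_eq0/mem_colonT => m.
    (* The exponent is doubled because (rs)^2 = r(srs): the n-th power of srs, which maps [M] into
       [P], divides (rs)^(2n). *)
    have -> : (r * s) ^+ (n + n) = r ^+ n * (s * (r * s)) ^+ n.
      by rewrite exprD -!exprMn !mulrA mulrAC.
    by rewrite -scalerA rpredZ.
  by left; apply/scaled_endo_quotmod_inj => m /primP[].
- case=> s Ss injP; exists s => // r N /scale_pred_subP rNP.
  have [/scaled_endo_quotmod_inj inj|[t t_gt0 /scale_quotmod_eq0 rst]] := injP r.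
    right; apply/scale_pred_subP => n Nn; apply: inj.
    (* Here (rs)n = s(rn), and rn is already in [P]. *)
    by rewrite mulrC -scalerA rpredZ ?rNP.
  by left; apply/asboolP; exists t; rewrite // mulrC.
- case=> s Ss primP; exists s => // J N JNP.
  (* The alternative must be the same for all of [J], so it is settled on [N] before any [j] is
     chosen. *)
  have [sNP|sNnP] := pselect {subset scale_pred s N <= P}; first by right.
  left => _ /asboolP[j Jj ->].
  have [] // := primP j N; apply/scale_pred_subP => n Nn.
  apply: JNP; apply/asboolP; exists [:: (j, n)]; last by rewrite big_seq1.
  by move=> p; rewrite inE => /eqP->.
- case=> s Ss primP; split=> //; exists s => // r m rmP.
  have [||sNP] := primP (cyclic_submod R R^o r) (cyclic_submod R M m).
  (* Each term (ar)(bm) of a sum in (Rr)(Rm) is a multiple of rm, hence in [P]. *)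
  + move=> _ /asboolP[u uJN ->]; rewrite big_seq rpred_sum // => p.
    move=> /uJN[/asboolP[a ->] /asboolP[b ->]].
    by rewrite scalerA mulrAC -scalerA rpredZ.
  + move=> srad; left; apply: srad; apply/asboolP; exists r => //.
    exact: mem_cyclic_submod.
  + right; move/scale_pred_subP: sNP; apply; exact: mem_cyclic_submod.
Qed.
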